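(* Let $G=(V,E)$ be any uniformly recurrent graph with bounded degrees such that, for every $\epsilon>0$, $$\sup_{x\in V}|\partial_e B(x,r)|\le e^{\epsilon r}\quad\text{for infinitely many } r\in\mathbb{N}.$$ Then $$\sup_{o\in V}\frac{H_o(R_n)}{\langle R_n\rangle_o}\longrightarrow 0\quad\text{as } n\to\infty .$$
   Context: $G=(V,E)$ is a graph with vertex set $V$ and edges given by unordered pairs of vertices; $x\sim y$ means $\{x,y\}\in E$, and $\deg(x)$ is the number of neighbors of $x$, always assumed finite, and at least $1$ so that the walk below is defined. $G$ has bounded degrees if $\sup_{x\in V}\deg(x)<\infty$. The graph distance $d(x,y)$ is the length of a shortest path from $x$ to $y$ ($\infty$ if there is none), $B(x,r)=\{y\in V:d(x,y)\le r\}$, and $|\partial_e B(x,r)|$ is the number of vertices at distance $r+1$ from $x$. For $o\in V$, $P_o$ (with expectation $E_o$) is the law of the simple random walk $(X_n)_{n\ge 0}$ on $G$ started at $X_0=o$, i.e. the Markov chain with transition probabilities $p(x,y)=1/\deg(x)$ if $x\sim y$ and $0$ otherwise. The range is $R_n=\{X_0,X_1,\dots,X_n\}$ (a random finite set of vertices), its expected size is $\langle R_n\rangle_o=E_o[|R_n|]$, and its entropy is $H_o(R_n)=\sum_{A}P_o[R_n=A]\log\big(1/P_o[R_n=A]\big)$, the sum being over all finite connected sets $A\subseteq V$ containing $o$, with $0\log(1/0)=0$. $G$ is uniformly recurrent if $\sup_{o\in V}P_o[o\notin\{X_1,\dots,X_n\}]\to 0$ as $n\to\infty$. *)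

(* Defs.v *)
From HB Require Import structures.
From mathcomp Require Import all_boot all_order all_algebra finmap.
From mathcomp Require Import all_classical all_reals all_analysis.
Set Implicit Arguments.
Unset Strict Implicit.
Unset Printing Implicit Defensive.
Import Order.TTheory GRing.Theory Num.Theory.
Import numFieldNormedType.Exports.
Local Open Scope classical_set_scope.
Local Open Scope ring_scope.

Section Graph.
Context {V : choiceType} (e : rel V).

Definition neighbors (x : V) : set V := [set y | e x y].

Definition locally_finite := forall x, finite_set (neighbors x).

(* [fset_set] of an infinite set is empty, so this is the number of neighbors
   only for locally finite graphs. *)
Definition deg (x : V) : nat := #|` fset_set (neighbors x)|%fset.

Definition bounded_degrees (R : realType) :=
  (ereal_sup [set ((deg x)%:R : R)%:E | x in [set: V]] < +oo)%E.

(* The infimum of the empty set is +oo: distance between components. *)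
Definition gdist (R : realType) (x y : V) : \bar R :=
  ereal_inf [set ((size p)%:R : R)%:E
            | p in [set p : seq V | path e x p /\ last x p = y]].

Definition outer_boundary (R : realType) (x : V) (r : nat) : set V :=
  [set y | gdist R x y = (r.+1%:R)%:E].

(* Spheres are finite in locally finite graphs, so [fset_set] is faithful. *)
Definition outer_boundary_size (R : realType) (x : V) (r : nat) : nat :=
  #|` fset_set (outer_boundary R x r)|%fset.

Definition subexponential_boundary_i_o (R : realType) :=
  forall eps : R, 0 < eps ->
    infinite_set [set r : nat |
      (ereal_sup [set ((outer_boundary_size R x r)%:R : R)%:E | x in [set: V]]
         <= (expR (eps * r%:R))%:E)%E].

Definition connected_in (A : {fset V}) :=
  forall x y, x \in A -> y \in A ->
    exists p : seq V, [/\ path e x p, last x p = y & all (mem A) p].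

Definition srw_step (R : realType) (x y : V) : R :=
  if e x y then (deg x)%:R^-1 else 0.

End Graph.

Section Walk.
Context {R : realType} {V : choiceType} (e : rel V).
Context {d : measure_display} {Omega : measurableType d}.

(* Under the law [P o], the process [X] is the simple random walk from [o]:
   the finite-dimensional distributions determine the law. *)
Definition is_srw (X : nat -> Omega -> V) (o : V) (P : probability Omega R) :=
  (forall n x, measurable [set w | X n w = x]) /\
  (forall n (x : nat -> V),
     P [set w | forall i, (i <= n)%N -> X i w = x i] =
     ((x 0%N == o)%:R * \prod_(i < n) srw_step e R (x i) (x i.+1))%:E).

Context (X : nat -> Omega -> V) (P : V -> probability Omega R).

Definition walk_range (n : nat) (w : Omega) : {fset V} :=
  [fset v in [seq X i w | i <- iota 0 n.+1]]%fset.

Definition expected_range (n : nat) (o : V) : \bar R :=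
  'E_(P o)[fun w => #|` walk_range n w|%fset%:R].

Definition prob_range (n : nat) (o : V) (A : {fset V}) : R :=
  fine (P o [set w | walk_range n w = A]).

(* The library has ln 0 = 0, so the terms of probability zero vanish. *)
Definition entropy_range (n : nat) (o : V) : \bar R :=
  (\esum_(A in [set A : {fset V} | connected_in e A /\ o \in A])
     (prob_range n o A * ln (prob_range n o A)^-1)%:E)%E.

Definition uniformly_recurrent :=
  (fun n : nat => ereal_sup
     [set P o [set w | forall i, (1 <= i <= n)%N -> X i w <> o]
     | o in [set: V]]) @ \oo --> 0%E.

End Walk.

(* Main.v *)
(* Fix eps and a radius r with sup_x |dB(x,r)| <= exp(eps r). Inside the range A
   choose a maximal r-separated set T containing o whose points are linked by
   jumps of length exactly r+1. The balls of radius r/2 around the points of T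
   are disjoint and each contains at least r/2 points of A, so T has at most
   about 2|A|/r points, and as each jump has at most exp(eps r) possible
   targets, T can be encoded with O(eps |A|) nats. Since A lies in the
   r-neighbourhood of T, it remains to encode which points of that
   neighbourhood are missing from A; this costs a constant per missing point
   and at most eps per point of A. By uniform recurrence a walk that comes
   within distance r of a point soon visits it with high probability, so the
   mean number of missing points is o(mean of |A|). Gibbs' inequality turns this
   code into the bound H(R_n) <= 8 eps E|R_n| for large n, uniformly in o. *)
Require Import Defs.
From HB Require Import structures.
From mathcomp Require Import all_boot all_order all_algebra finmap.
From mathcomp Require Import all_classical all_reals all_analysis.
From mathcomp Require Import measurable_realfun zify ring lra.
Set Implicit Arguments.
Unset Strict Implicit.
Unset Printing Implicit Defensive.
Import Order.TTheory GRing.Theory Num.Theory.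
Import numFieldNormedType.Exports.
Local Open Scope classical_set_scope.
Local Open Scope ring_scope.

(** * Balls, spheres and skeletons *)

Lemma in_fset_seq (V : choiceType) (s : seq V) y :
  (y \in [fset z in s]%fset) = (y \in s).
Proof. by rewrite in_fset. Qed.

Lemma in_fset_sieve (V : choiceType) (s : seq V) (Q : pred V) y :
  (y \in [fset z in s | Q z]%fset) = (y \in s) && Q y.
Proof. by rewrite in_fset !inE. Qed.

Lemma ltn_cardfs (V : choiceType) (A B : {fset V}) z :
  {subset A <= B} -> z \in B -> z \notin A -> (#|` A| < #|` B|)%N.
Proof.
move=> /fsubsetP AB zB zA; apply: fproper_ltn_card; rewrite fproperE AB /=.
by apply/negP => /fsubsetP/(_ z zB); rewrite (negPf zA).
Qed.

Section Balls.
Context {V : choiceType} (e : rel V).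
Hypotheses (e_sym : symmetric e) (e_lf : locally_finite e).
Implicit Types (x y z o : V) (s : seq V) (A T : {fset V}).

Definition nbr x : {fset V} := fset_set (neighbors e x).

Lemma mem_nbr x y : (y \in nbr x) = e x y.
Proof. by rewrite in_fset_set //; apply/idP/idP; rewrite inE. Qed.

(** The ball as a list with repetitions: its size obeys a plain power bound, and counting over it
    can only overestimate. *)
Fixpoint gball k x : seq V :=
  if k is k'.+1 then flatten [seq y :: nbr y | y <- gball k' x] else [:: x].

Lemma gballSP k x y :
  reflect (exists2 z, z \in gball k x & (y == z) || e z y) (y \in gball k.+1 x).
Proof.
apply: (iffP flattenP) => /= [[_ /mapP[z zk ->]]|[z zk yz]].
  by rewrite inE mem_nbr => yz; exists z.
by exists (z :: nbr z); [apply/mapP; exists z | rewrite inE mem_nbr].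
Qed.

Lemma gball_center k x : x \in gball k x.
Proof.
by elim: k => [|k IH]; [rewrite mem_head | apply/gballSP; exists x; rewrite ?eqxx].
Qed.

Lemma gball_le k l x y : (k <= l)%N -> y \in gball k x -> y \in gball l x.
Proof.
move=> /subnK <-; elim: (l - k)%N => // j IH /IH yj.
by apply/gballSP; exists y; rewrite ?eqxx.
Qed.

Lemma gball_step k x y z : y \in gball k x -> e y z -> z \in gball k.+1 x.
Proof. by move=> yk yz; apply/gballSP; exists y; rewrite ?yz ?orbT. Qed.

Lemma gball_triangle k l x y z :
  y \in gball k x -> z \in gball l y -> z \in gball (k + l) x.
Proof.
move=> yk; elim: l z => [|l IH] z; first by rewrite inE addn0 => /eqP ->.
by case/gballSP => w /IH wl zw; rewrite addnS; apply/gballSP; exists w.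
Qed.

Lemma gball_sym k x y : y \in gball k x -> x \in gball k y.
Proof.
elim: k y => [|k IH] y; first by rewrite !inE eq_sym.
case/gballSP => z /IH xz yz; rewrite -add1n; apply: (@gball_triangle _ _ _ z) => //.
by apply/gballSP; exists y; rewrite ?mem_head // eq_sym e_sym.
Qed.

Lemma size_gball D k x : (forall y, deg e y <= D)%N ->
  (size (gball k x) <= D.+1 ^ k)%N.
Proof.
move=> degD; elim: k => //= k IH; rewrite size_flatten /shape -map_comp.
apply: (@leq_trans (size (gball k x) * D.+1)); last by rewrite expnSr leq_mul2r IH orbT.
elim: (gball k x) => //= y s IHs; rewrite mulSn leq_add // ltnS; exact: degD.
Qed.

Lemma gball_path k x y : y \in gball k x ->
  exists p, [/\ path e x p, last x p = y & (size p <= k)%N].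
Proof.
elim: k y => [|k IH] y; first by rewrite inE => /eqP ->; exists [::].
case/gballSP => z /IH[p [xp pz pk]] /orP[/eqP ->|zy].
  by exists p; split => //; apply: leqW.
by exists (rcons p y); rewrite rcons_path xp pz last_rcons size_rcons.
Qed.

Lemma path_gball x p : path e x p -> last x p \in gball (size p) x.
Proof.
elim/last_ind: p => [|p y IH]; first by rewrite mem_head.
rewrite rcons_path last_rcons size_rcons => /andP[/IH]; exact: gball_step.
Qed.

(** Index [k] means distance exactly [k.+1], in step with [outer_boundary]. As a relation it gives
    the long jumps of the skeleton. *)
Definition sphere k : rel V :=
  fun x y => (y \in gball k.+1 x) && (y \notin gball k x).

Definition sphere_fset k x : {fset V} :=
  [fset y in gball k.+1 x | y \notin gball k x]%fset.

Lemma gdist_sphere (R : realType) k x y :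
  sphere k x y -> gdist e R x y = (k.+1%:R)%:E.
Proof.
case/andP => yk ykN; apply/eqP; rewrite eq_le; apply/andP; split.
  have [p [xp py pk]] := gball_path yk.
  apply: (@le_trans _ _ ((size p)%:R : R)%:E); last by rewrite lee_fin ler_nat.
  by apply: ereal_inf_lbound; exists p.
apply: le_ereal_inf_tmp => _ [p [xp py] <-]; rewrite lee_fin ler_nat ltnNge.
apply/negP => pk; move/negP: ykN; apply; apply: gball_le pk _.
by rewrite -py; apply: path_gball.
Qed.

Lemma finite_outer_boundary (R : realType) k x :
  finite_set (outer_boundary e R x k).
Proof.
apply: (@sub_finite_set _ _ [set` gball k.+1 x]); last exact: finite_seq.
move=> y /= yk.
have : (gdist e R x y < k.+2%:R%:E)%E by rewrite yk lte_fin ltr_nat.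
move=> /ereal_inf_lt[_ [p [xp <-] <-]]; rewrite lte_fin ltr_nat ltnS => pk.
by apply: gball_le pk _; apply: path_gball.
Qed.

Lemma card_sphere (R : realType) k x :
  (#|` sphere_fset k x| <= outer_boundary_size e R x k)%N.
Proof.
apply/fsubset_leq_card/fsubsetP => y; rewrite in_fset_sieve => yk.
rewrite in_fset_set; last exact: finite_outer_boundary.
by rewrite inE /=; apply: gdist_sphere.
Qed.

(* Connectedness of [A] from [o], phrased through cuts so that it serves both
   the graph relation and the coarse relations [sphere k]. *)
Definition reach (adj : rel V) o (A : {fset V}) :=
  forall Q : pred V, Q o -> forall t, t \in A -> ~~ Q t ->
  exists a b, [/\ a \in A, b \in A, Q a, ~~ Q b & adj a b].

Lemma reach1 adj o : reach adj o [fset o]%fset.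
Proof. by move=> Q Qo t; rewrite inE => /eqP ->; rewrite Qo. Qed.

(** If [Q] already fails somewhere in [A], a crossing pair lies in [A]; otherwise it fails only at
    [b], and the pair [a], [b] crosses. *)
Lemma reachU1 adj o A a b : reach adj o A -> a \in A -> adj a b ->
  reach adj o (b |` A)%fset.
Proof.
move=> rA aA ab Q Qo t; rewrite !inE => tA QtN.
have [[c [cA QcN]]|AQ] : (exists c, c \in A /\ ~~ Q c) \/ {in A, forall c, Q c}.
- have [/allP AQ|/allPn[c cA QcN]] := boolP (all Q A); first by right.
  by left; exists c.
- have [u [v [uA vA Qu QvN uv]]] := rA Q Qo c cA QcN.
  by exists u, v; split; rewrite // inE ?uA ?vA orbT.
- move: tA => /orP[/eqP tb|/AQ]; last by rewrite (negPf QtN).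
  by exists a, b; split; rewrite ?inE ?aA ?eqxx ?orbT //; [apply: AQ | rewrite -tb].
Qed.

Lemma reach_path o p : path e o p -> reach e o [fset y in o :: p]%fset.
Proof.
elim/last_ind: p => [|p y IH].
  have -> : [fset y in [:: o]]%fset = [fset o]%fset by apply/fsetP => y; rewrite in_fset_seq !inE.
  by move=> _; apply: reach1.
rewrite rcons_path => /andP[/IH rp py].
have -> : [fset z in o :: rcons p y]%fset = (y |` [fset z in o :: p])%fset.
  by apply/fsetP => z; rewrite in_fset1U !in_fset_seq -rcons_cons mem_rcons in_cons.
by apply: reachU1 rp _ py; rewrite in_fset_seq mem_last.
Qed.

Lemma card_disjoint (F : V -> {fset V}) m A s : uniq s ->
  {in s &, forall x y, x != y -> [disjoint F x & F y]%fset} ->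
  {in s, forall x, m <= #|` A `&` F x|%fset}%N -> (size s * m <= #|` A|)%N.
Proof.
elim: s A => //= x s IH A /andP[xs us] dF hm.
have := cardfsID (F x) A; rewrite mulSn => <-.
apply: leq_add; first by apply: hm; rewrite mem_head.
apply: IH => // [y z ys zs|y ys]; first by apply: dF; rewrite in_cons ?ys ?zs orbT.
have yx : y != x by apply: contraNneq xs => <-.
apply: leq_trans (hm y _) _; first by rewrite in_cons ys orbT.
apply/fsubset_leq_card/fsubsetP => z; rewrite !inE => /andP[zA zy].
rewrite zA zy !andbT.
have /fdisjointP/(_ z zy) : [disjoint F y & F x]%fset by
  apply: dF yx; rewrite ?mem_head // in_cons ys orbT.
by [].
Qed.

(** * Separated sets and skeletons of connected sets *)

Definition nearby r s : {fset V} := [fset y in flatten [seq gball r x | x <- s]]%fset.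

Lemma nearbyP r s y :
  reflect (exists2 x, x \in s & y \in gball r x) (y \in nearby r s).
Proof.
rewrite in_fset_seq; apply: (iffP flattenP) => [[_ /mapP[x xs ->] yx]|[x xs yx]].
  by exists x.
by exists (gball r x) => //; apply: map_f.
Qed.

Definition separated r T := {in T &, forall x y, x != y -> y \notin gball r x}.

(** For [k < h] the ball of radius [k] around [x] contains [x] but not [t], so connectedness of [A]
    puts a new point of [A] in the next ball. *)
Lemma card_gball_reach o A h x : o \in A -> reach e o A -> x \in A ->
  (exists2 t, t \in A & t \notin gball h x) ->
  (h < #|` A `&` [fset y in gball h x]|%fset)%N.
Proof.
move=> oA rA xA [t tA th].
have grow k : (k < h)%N -> exists y, [/\ y \in A, y \in gball k.+1 x & y \notin gball k x].
  move=> kh; have tk : t \notin gball k x by apply: contra th; apply/gball_le/ltnW.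
  (* [reach] only treats cuts with [o] on the [Q] side, so [Q] is the ball or its complement
     according to where [o] lies. *)
  have [ok|okN] := boolP (o \in gball k x).
    have [a [b [aA bA ak bk ab]]] := rA (fun y => y \in gball k x) ok t tA tk.
    by exists b; split=> //; apply: gball_step ak ab.
  have [|a [b [aA bA ak bk ab]]] := rA (fun y => y \notin gball k x) okN x xA.
    by rewrite negbK gball_center.
  exists a; split=> //; rewrite negbK in bk.
  by apply: gball_step bk _; rewrite e_sym.
suff H k : (k <= h)%N -> (k < #|` A `&` [fset y in gball k x]|%fset)%N by exact: H.
elim: k => [|k IH] kh.
  by rewrite cardfs_gt0; apply/fset0Pn; exists x; rewrite in_fsetI xA in_fset_seq mem_head.
apply: leq_ltn_trans (IH (ltnW kh)) _.
have [y [yA yk ykN]] := grow k kh.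
apply: (@ltn_cardfs _ _ _ y) => [z||]; rewrite !in_fsetI !in_fset_seq ?yA //=.
by move=> /andP[-> /(gball_le (leqnSn _))].
Qed.

(** Balls of radius [r./2] around the points of [T] are disjoint, and each misses another point of
    [T], hence holds more than [r./2] points of [A]. A singleton [T] has no such other point, whence
    the subtraction of one. *)
Lemma separated_card o A T r : o \in A -> reach e o A -> {subset T <= A} ->
  separated r T -> ((#|` T| - 1) * r <= 2 * #|` A|)%N.
Proof.
move=> oA rA TA sT; have [T1|T2] := leqP #|` T| 1.
  by move: T1; rewrite -subn_eq0 => /eqP ->.
suff : (#|` T| * (r./2).+1 <= #|` A|)%N.
  have := odd_double_half r; nia.
apply: (card_disjoint (F := fun x => [fset y in gball r./2 x]%fset)).
- exact: fset_uniq.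
- move=> x y xT yT xy; apply/fdisjointP => z; rewrite !in_fset_seq => zx.
  apply/negP => /gball_sym zy; have /negP := sT x y xT yT xy; apply.
  apply: gball_le (gball_triangle zx zy).
  by rewrite addnn -[leqRHS]odd_double_half leq_addl.
- move=> x xT; apply: (@card_gball_reach o) => //; first exact: TA.
  have [y yT yx] : exists2 y, y \in T & y != x.
    have : (0 < #|` T `\ x|%fset)%N by move: T2; rewrite (cardfsD1 x) xT.
    by rewrite cardfs_gt0 => /fset0Pn[y]; rewrite !inE => /andP[yx yT]; exists y.
  exists y; first exact: TA.
  apply: contra (sT x y xT yT _); last by rewrite eq_sym.
  by apply: gball_le; have := odd_double_half r; lia.
Qed.

(** Greedy construction from the singleton of [o]. While [A] leaves the [r]-neighbourhood of [T], an
    edge of [A] crosses its border; the outer endpoint is at distance exactly [r.+1] from a point of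
    [T] and beyond [r] from all of them, so it can be added. *)
Lemma skeleton o A r : o \in A -> reach e o A ->
  exists T : {fset V}, [/\ {subset T <= A}, o \in T, reach (sphere r) o T,
    {subset A <= nearby r T} & ((#|` T| - 1) * r <= 2 * #|` A|)%N].
Proof.
move=> oA rA.
(* [k] bounds the number of points that can still be added. *)
suff H k T : (#|` A `\` T|%fset <= k)%N -> {subset T <= A} -> o \in T ->
    reach (sphere r) o T -> separated r T ->
  exists T', [/\ {subset T' <= A}, o \in T', reach (sphere r) o T',
    {subset A <= nearby r T'} & separated r T'].
  have [||||T' [TA oT rT AT sT]] := H _ [fset o]%fset (leqnn _).
  - by move=> x; rewrite inE => /eqP ->.
  - by rewrite inE.
  - exact: reach1.
  - by move=> x y; rewrite !inE => /eqP -> /eqP ->; rewrite eqxx.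
  by exists T'; split => //; apply: (@separated_card o).
elim: k T => [|k IH] T AT TA oT rT sT;
  have [/allP AN|/allPn[t tA tN]] := boolP (all (mem (nearby r T)) A);
  try by exists T.
  move: AT; rewrite leqn0 cardfs_eq0 => /eqP/fsetP/(_ t).
  rewrite !inE tA andbT => /negbFE tT.
  by case/negP: tN; apply/nearbyP; exists t => //; apply: gball_center.
have oN : o \in nearby r T by apply/nearbyP; exists o => //; apply: gball_center.
have [a [b [aA bA /nearbyP[x xT ax] bN ab]]] := rA (mem (nearby r T)) oN t tA tN.
have bT y : y \in T -> b \notin gball r y.
  by move=> yT; apply: contra bN => yb; apply/nearbyP; exists y.
have xb : sphere r x b by rewrite /sphere bT // (gball_step ax ab).
apply: (IH (b |` T)%fset).
- rewrite -ltnS; apply: leq_trans AT; apply: (@ltn_cardfs _ _ _ b) => [y||].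
  + by rewrite !inE => /andP[/norP[_ ->] ->].
  + by rewrite !inE bA andbT; apply/negP => /bT; rewrite gball_center.
  + by rewrite !inE eqxx.
- by move=> y; rewrite !inE => /orP[/eqP ->|/TA].
- by rewrite !inE oT orbT.
- exact: reachU1 rT xT xb.
- move=> y z; rewrite !inE => /orP[/eqP ->|yT] /orP[/eqP ->|zT]; rewrite ?eqxx // => yz.
  + by apply: contra (bT z zT) => /gball_sym.
  + exact: bT.
  + exact: sT.
Qed.

(** Either each of the first [L] enlargements adds a vertex, or one adds none and the ball is closed
    under adjacency from then on. *)
Lemma gball_growth L o :
  (L < #|` [fset y in gball L o]|%fset)%N \/
  (forall x y, x \in gball L o -> e x y -> y \in gball L o).
Proof.
elim: L => [|L [IH|IH]].
- by left; rewrite cardfs_gt0; apply/fset0Pn; exists o; rewrite in_fset_seq mem_head.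
- have [/allP sub|/allPn[z zL zLN]] := boolP (all (mem (gball L o)) (gball L.+1 o)).
    by right => x y /sub xL xy; apply: gball_step xL xy.
  left; apply: leq_ltn_trans IH _; apply: (@ltn_cardfs _ _ _ z) => [y||]; rewrite ?in_fset_seq //.
  exact: gball_le.
- right => x y /gballSP[z zL xz] xy; apply: gball_le (leqnSn L) _.
  apply: (IH x y) xy; move: xz => /orP[/eqP -> //|]; exact: IH.
Qed.

End Balls.

(** * Encoding the range *)

Section Code.
Context {R : realType}.

Definition bit_weight (p : R) (a : option bool) : R :=
  if a is Some b then (if b then p else 1 - p) else 1.

Definition bit_conflict (a b : option bool) :=
  if (a, b) is (Some x, Some y) then x != y else false.

(* The events "the independent bits indexed by U agree with the partial
   configuration S A" are pairwise disjoint. *)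
Lemma kraft (K I : eqType) (p : K -> R) (S : I -> K -> option bool)
    (F : seq I) (U : seq K) :
  (forall i, 0 <= p i <= 1) -> uniq F ->
  {in F &, forall A B, A != B -> has (fun i => bit_conflict (S A i) (S B i)) U} ->
  \sum_(A <- F) \prod_(i <- U) bit_weight (p i) (S A i) <= 1.
Proof.
move=> p01; elim: U F => [|i U IH] F uF cF.
  (* With no bit left nothing can conflict, so [F] has at most one element. *)
  case: F uF cF => [|A [|B F]] /=; rewrite ?big_nil ?big_seq1 ?big_nil //.
  rewrite inE negb_or => /andP[/andP[AB _] _] cF.
  by have := cF A B; rewrite !inE !eqxx orbT /= => /(_ isT isT AB).
(* Condition on the value [b] of bit [i]: members of [G b] do not conflict at [i], so they conflict
   within [U]. Those leaving [i] unspecified occur in both halves. *)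
pose G b := [seq A <- F | S A i != Some (~~ b)].
have sumG b : \sum_(A <- G b) \prod_(j <- U) bit_weight (p j) (S A j) <= 1.
  apply: IH; first exact: filter_uniq.
  move=> A B; rewrite !mem_filter => /andP[Ai AF] /andP[Bi BF] /(cF A B AF BF) /=.
  by case/orP => //; move: Ai Bi; case: (S A i) (S B i) b => [[]|] [[]|] [].
have /andP[p0 p1] := p01 i; have q0 : 0 <= 1 - p i by rewrite subr_ge0.
have -> : \sum_(A <- F) \prod_(j <- i :: U) bit_weight (p j) (S A j) =
  p i * (\sum_(A <- G true) \prod_(j <- U) bit_weight (p j) (S A j)) +
  (1 - p i) * (\sum_(A <- G false) \prod_(j <- U) bit_weight (p j) (S A j)).
  rewrite !big_filter !big_distrr /= 2!(big_mkcond (fun A => S A i != _)) -big_split /=.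
  apply: eq_bigr => A _; rewrite big_cons.
  by case: (S A i) => [[]|] /=; rewrite ?addr0 ?add0r // -mulrDl addrC subrK.
apply: le_trans (lerD (ler_wpM2l p0 (sumG true)) (ler_wpM2l q0 (sumG false))) _.
by rewrite !mulr1 addrC subrK.
Qed.

Lemma sum_if_le (V : choiceType) (U : seq V) (a b : pred V) (A B : {fset V}) (u v : R) :
  uniq U -> 0 <= u -> 0 <= v -> (forall x, a x -> x \in A) ->
  (forall x, ~~ a x -> b x -> x \in B) ->
  \sum_(x <- U) (if a x then u else if b x then v else 0) <=
    u * #|` A|%:R + v * #|` B|%:R.
Proof.
move=> uU u0 v0 aA bB.
have sum1 (c : pred V) (C : {fset V}) (w : R) : 0 <= w -> (forall x, c x -> x \in C) ->
    \sum_(x <- U | c x) w <= w * #|` C|%:R.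
  move=> w0 cC; rewrite big_const_seq iter_addr_0 mulr_natr.
  rewrite ler_wpMn2l //.
  rewrite -size_filter uniq_leq_size ?filter_uniq // => x.
  by rewrite mem_filter => /andP[/cC].
apply: le_trans (lerD (sum1 a A u u0 aA) (sum1 (fun x => ~~ a x && b x) B v v0 _)).
  rewrite [X in _ <= X + _]big_mkcond [X in _ <= _ + X]big_mkcond -big_split /=.
  by apply: ler_sum => x _; case: (a x); case: (b x); rewrite ?addr0 ?add0r.
by move=> x /andP[]; apply: bB.
Qed.

(** From [1 / (1 - p) <= 1 + 2 * p <= expR (2 * p)]. It prices a closed site of density [p] at
    [2 * p] nats. *)
Lemma expR_le_1B (p : R) : 0 <= p -> p <= 2^-1 -> expR (- (2 * p)) <= 1 - p.
Proof.
move=> p0 p12; have p1 : 0 < 1 - p by lra.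
rewrite expRN -[leRHS]invrK lef_pV2 ?posrE ?invr_gt0 ?expR_gt0 //.
apply: le_trans (expR_ge1Dx _); rewrite invf_ple ?posrE //; last by lra.
by rewrite -[leLHS]mul1r ler_pdivrMr; nra.
Qed.

Section Graph.
Context {V : choiceType} (e : rel V).
Hypotheses (e_sym : symmetric e) (e_lf : locally_finite e).

Lemma card_flatten_fset (F : V -> {fset V}) (T : {fset V}) (b : R) :
  (forall x, #|` F x|%:R <= b) ->
  #|` [fset y in flatten [seq enum_fset (F x) | x <- T]]%fset|%:R <= #|` T|%:R * b.
Proof.
move=> Fb; apply: (@le_trans _ _ (size (flatten [seq enum_fset (F x) | x <- T]))%:R).
  by rewrite ler_nat card_fseq size_undup.
rewrite size_flatten /shape -map_comp; elim: (enum_fset T) => [|x s IH] /=.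
  by rewrite mul0r.
by rewrite natrD -add1n natrD mulrDl mul1r lerD.
Qed.

(* The weight q A is the probability that, in two independent site
   percolations, the open cluster of o for the relation [sphere e r] is the
   skeleton T A, and the configuration on the r-neighbourhood of T A is A. *)
Lemma range_code (o : V) (r : nat) (eps : R) (F : seq {fset V}) :
  0 < eps -> expR (- (eps * r%:R)) <= eps -> expR (- (eps * r%:R)) <= 2^-1 ->
  (forall x, #|` sphere_fset e r x|%:R <= expR (eps * r%:R)) ->
  uniq F -> {in F, forall A, o \in A /\ reach e o A} ->
  exists2 q : {fset V} -> R, \sum_(A <- F) q A <= 1 &
    {in F, forall A, expR (- (7 * eps * #|` A|%:R
        - ln (1 - expR (- eps)) * #|` nearby e r A `\` A|%fset%:R)) <= q A}.
Proof.
move=> eps0 er_eps er_half sphb uF rF.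
have /choice[T TP] : forall A, exists T : {fset V}, A \in F ->
    [/\ {subset T <= A}, o \in T, reach (sphere e r) o T,
     {subset A <= nearby e r T} & ((#|` T| - 1) * r <= 2 * #|` A|)%N].
  move=> A.
  have [AF|] := boolP (A \in F); last by exists fset0.
  by have [oA rA] := rF A AF; have [T ?] := skeleton e_sym e_lf r oA rA; exists T.
(* An open skeleton site costs [2 * eps * r] nats. With at most [expR (eps * r)] jump targets, those
   of one skeleton point have total density at most [expR (- (eps * r))], hence at most [eps]. *)
pose p : R := expR (- (2 * eps * r%:R)).
pose dT A := [fset y in flatten [seq enum_fset (sphere_fset e r x) | x <- T A]]%fset.
have dTP A a b : a \in T A -> sphere e r a b -> b \in dT A.
  move=> aT ab; rewrite in_fset_seq; apply/flattenP.
  exists (enum_fset (sphere_fset e r a)); first exact: map_f.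
  by have := in_fset_sieve (gball e r.+1 a) (fun y => y \notin gball e r a) b;
    rewrite -/(sphere e r a b) ab.
(* Flag [true] carries the skeleton bits, with [o] left free; flag [false] carries the bits that
   fill in [A] around its skeleton. *)
pose S (A : {fset V}) (i : bool * V) :=
  if i.1 then
    if (i.2 \in T A) && (i.2 != o) then Some true
    else if (i.2 \notin T A) && (i.2 \in dT A) then Some false else None
  else if i.2 \in A then Some true
    else if i.2 \in nearby e r (T A) then Some false else None.
pose P (i : bool * V) : R := if i.1 then p else expR (- eps).
(* Every conflict found below sits at a site of some set in [F], so these sites suffice. *)
pose U0 := undup (flatten [seq enum_fset A | A : {fset V} <- F]).
have memU0 A x : A \in F -> x \in A -> x \in U0.
  move=> AF xA; rewrite mem_undup; apply/flattenP.
  by exists (enum_fset A) => //; apply: map_f.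
pose U := [seq (true, x) | x <- U0] ++ [seq (false, x) | x <- U0].
have eps1 : expR (- eps) < 1 by rewrite expR_lt1 oppr_lt0.
have eps_er : 0 <= eps * r%:R by rewrite mulr_ge0 // ltW.
have pE : p = expR (- (eps * r%:R)) * expR (- (eps * r%:R)).
  by rewrite /p -expRD; congr expR; ring.
have er1 : expR (- (eps * r%:R)) <= 1 by rewrite expR_le1 oppr_le0.
have er0 := expR_gt0 (- (eps * r%:R)).
exists (fun A => \prod_(i <- U) bit_weight (P i) (S A i)).
  apply: kraft => // [[[] x]|A B AF BF AB]; rewrite /P /=.
  - by rewrite expR_ge0 expR_le1 oppr_le0 -mulrA mulr_ge0.
  - by rewrite expR_ge0 ltW.
  (* Equal skeletons: a point of one set outside the other lies in the common neighbourhood, so the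
     filling bits conflict. *)
  have [TAB|TAB] := eqVneq (T A) (T B).
    have AB' (C D : {fset V}) x : C \in F -> D \in F -> T C = T D -> x \in C ->
        x \notin D -> (false, x) \in U /\
        bit_conflict (S C (false, x)) (S D (false, x)).
      move=> CF DF TCD xC xD; split.
        by rewrite mem_cat; apply/orP; right; apply: map_f; apply: memU0 xC.
      rewrite /S /= xC (negPf xD) -TCD; have [_ _ _ sC _] := TP C CF.
      by rewrite (sC x xC).
    have [/fsubsetP sAB|/fsubsetPn[x xA xB]] := boolP (A `<=` B)%fset; last first.
      by have [? ?] := AB' A B x AF BF TAB xA xB; apply/hasP; exists (false, x).
    have [/fsubsetP sBA|/fsubsetPn[x xB xA]] := boolP (B `<=` A)%fset; last first.
      have [? c] := AB' B A x BF AF (esym TAB) xB xA; apply/hasP; exists (false, x) => //.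
      by move: c; case: (S A _) (S B _) => [[]|] [[]|].
    by case/eqP: AB; apply/fsetP => x; apply/idP/idP; [apply: sAB | apply: sBA].
  (* Different skeletons: some jump inside [T C] leaves [T D]. Its endpoint is open for [C] and
     closed for [D], and is not [o], which lies in [T D]. *)
  have TAB' (C D : {fset V}) x : C \in F -> D \in F -> x \in T C -> x \notin T D ->
      exists2 i, i \in U & bit_conflict (S C i) (S D i).
    move=> CF DF xC xD; have [sC _ rC _ _] := TP C CF; have [_ oD _ _ _] := TP D DF.
    have [a [b [aC bC aD bD ab]]] := rC (fun y => y \in T D) oD x xC xD.
    exists (true, b).
      by rewrite mem_cat; apply/orP; left; apply: map_f; apply: (memU0 C) => //; apply: sC.
    rewrite /S /= bC (negPf bD) (dTP D a b aD ab) /=.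
    by case: eqVneq bD => [->|]; rewrite ?oD.
  have [/fsubsetP sAB|/fsubsetPn[x xA xB]] := boolP (T A `<=` T B)%fset; last first.
    by apply/hasP; apply: TAB' xA xB.
  have [/fsubsetP sBA|/fsubsetPn[x xB xA]] := boolP (T B `<=` T A)%fset; last first.
    apply/hasP; have [i iU c] := TAB' B A x BF AF xB xA; exists i => //.
    by move: c; case: (S A _) (S B _) => [[]|] [[]|].
  by case/eqP: TAB; apply/fsetP => x; apply/idP/idP; [apply: sAB | apply: sBA].
move=> A AF; have [TA oT _ AT cardT] := TP A AF.
(* The price of a closed filling site, that is, of a missing vertex. *)
set c := - ln (1 - expR (- eps)).
have c0 : 0 <= c by rewrite oppr_ge0 ln_le0 // lerBlDr lerDl expR_ge0.
have cE : expR (- c) = 1 - expR (- eps) by rewrite opprK lnK // posrE subr_gt0.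
pose cost (i : bool * V) :=
  if i.1 then
    if (i.2 \in T A) && (i.2 != o) then 2 * eps * r%:R
    else if (i.2 \notin T A) && (i.2 \in dT A) then 2 * p else 0
  else if i.2 \in A then eps
    else if i.2 \in nearby e r (T A) then c else 0.
have p0 : 0 <= p by apply: expR_ge0.
have wcost i : expR (- cost i) <= bit_weight (P i) (S A i).
  rewrite /cost /S /P; case: i => -[] x /=.
    case: ifP => //= _; case: ifP => _ /=; last by rewrite oppr0 expR0.
    by apply: expR_le_1B => //; rewrite pE; nra.
  by case: ifP => //= _; case: ifP => _ /=; rewrite ?cE // oppr0 expR0.
apply: (@le_trans _ _ (\prod_(i <- U) expR (- cost i))); last first.
  by apply: ler_prod => i _; rewrite expR_ge0 wcost.
rewrite -expR_sum ler_expR sumrN lerN2 /U big_cat !big_map /= /cost /=.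
have TcA : #|` T A|%:R <= #|` A|%:R :> R by rewrite ler_nat fsubset_leq_card //; apply/fsubsetP.
have uU0 : uniq U0 by apply: undup_uniq.
have := @sum_if_le _ U0 (mem A) (mem (nearby e r (T A))) A (nearby e r A `\` A)%fset eps c uU0 (ltW eps0) c0.
move=> /(_ (fun x xA => xA)) sum2.
have := @sum_if_le _ U0 (fun x => (x \in T A) && (x != o))
  (fun x => (x \notin T A) && (x \in dT A)) (T A `\ o)%fset (dT A) (2 * eps * r%:R) (2 * p) uU0.
move=> sum1.
apply: le_trans (lerD (sum1 _ _ _ _) (sum2 _)) _.
- by rewrite -mulrA mulr_ge0.
- by rewrite mulr_ge0.
- by move=> x; rewrite !inE andbC.
- by move=> x _ /andP[].
- move=> x xA /nearbyP[t tT tx]; rewrite in_fsetD [x \notin A]xA /=.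
  by apply/nearbyP; exists t => //; apply: TA.
have -> : #|` T A `\ o|%fset = (#|` T A| - 1)%N by rewrite (cardfsD1 o (T A)) oT add1n subn1.
(* Budget per point of [A]: [4 * eps] for open skeleton sites, [2 * eps] for closed targets and
   [eps] for the filling, in total [7 * eps]. *)
have h1 : 2 * eps * r%:R * (#|` T A| - 1)%:R <= 4 * eps * #|` A|%:R.
  have : (((#|` T A| - 1) * r)%:R <= (2 * #|` A|)%:R :> R) by rewrite ler_nat.
  by rewrite !natrM; nra.
have h2 : 2 * p * #|` dT A|%:R <= 2 * eps * #|` A|%:R.
  have := card_flatten_fset (T A) sphb; rewrite -/(dT A) => dTb.
  have pe : p * expR (eps * r%:R) <= eps.
    by rewrite pE -mulrA -expRD addNr expR0 mulr1.
  have := ler_wpM2l p0 dTb; have : (0 : R) <= #|` T A|%:R by []; nra.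
rewrite mulNr; lra.
Qed.

End Graph.
End Code.

(** * Means over finite walks *)

Section Walk.
Context {R : realType} {V : choiceType} (e : rel V).
Hypotheses (e_sym : symmetric e) (e_lf : locally_finite e).
Hypothesis e_deg : forall x, (1 <= deg e x)%N.

(* Expectation of [f (X_1, ..., X_n)] for the walk started at [x]. *)
Fixpoint walk_mean n (x : V) (f : seq V -> R) : R :=
  if n is m.+1 then
    (deg e x)%:R^-1 * \sum_(y <- nbr e x) walk_mean m y (fun s => f (y :: s))
  else f [::].

Lemma walk_mean_le n x f g :
  (forall s, path e x s -> size s = n -> f s <= g s) ->
  walk_mean n x f <= walk_mean n x g.
Proof.
elim: n x f g => [|n IH] x f g fg; first exact: fg.
rewrite /= ler_wpM2l ?invr_ge0 // big_seq [leRHS]big_seq ler_sum // => y.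
rewrite mem_nbr // => xy; apply: IH => s ys sn.
by apply: fg; rewrite /= ?xy ?sn.
Qed.

Lemma walk_mean_eq n x f g :
  (forall s, path e x s -> size s = n -> f s = g s) ->
  walk_mean n x f = walk_mean n x g.
Proof.
by move=> fg; apply/eqP; rewrite eq_le !walk_mean_le // => s xs sn; rewrite (fg s).
Qed.

Lemma walk_meanD n x f g :
  walk_mean n x (fun s => f s + g s) = walk_mean n x f + walk_mean n x g.
Proof.
elim: n x f g => //= n IH x f g; rewrite -mulrDr -big_split /=.
by under eq_bigr do rewrite IH.
Qed.

Lemma walk_meanZ n x c f :
  walk_mean n x (fun s => c * f s) = c * walk_mean n x f.
Proof.
elim: n x f => //= n IH x f; under eq_bigr do rewrite IH.
by rewrite -big_distrr mulrCA.
Qed.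

Lemma mean_cst x (c : R) : (deg e x)%:R^-1 * \sum_(y <- nbr e x) c = c.
Proof.
rewrite big_const_seq count_predT iter_addr_0 -[c *+ _]mulr_natl mulrA mulVf ?mul1r //.
by rewrite pnatr_eq0 -lt0n e_deg.
Qed.

Lemma walk_mean_cst n x c : walk_mean n x (fun=> c) = c.
Proof.
by elim: n x => //= n IH x; under eq_bigr do rewrite IH; rewrite mean_cst.
Qed.

Lemma walk_mean_sum n x (I : Type) (r : seq I) (f : I -> seq V -> R) :
  walk_mean n x (fun s => \sum_(i <- r) f i s) = \sum_(i <- r) walk_mean n x (f i).
Proof.
elim: r => [|i r IH].
  rewrite big_nil -[RHS](walk_mean_cst n x).
  by apply: walk_mean_eq => s; rewrite big_nil.
rewrite big_cons -IH -walk_meanD.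
by apply: walk_mean_eq => s; rewrite big_cons.
Qed.

(** * Hitting probabilities under uniform recurrence *)

Definition avoid n x y : R := walk_mean n x (fun s => (y \notin x :: s)%:R).

Lemma avoidxx n x : avoid n x x = 0.
Proof.
rewrite /avoid -[RHS](walk_mean_cst n x).
by apply: walk_mean_eq => s; rewrite mem_head.
Qed.

Lemma avoidS n x y : x != y ->
  avoid n.+1 x y = (deg e x)%:R^-1 * \sum_(z <- nbr e x) avoid n z y.
Proof.
move=> xy; congr (_ * _); apply: eq_bigr => z _; apply: walk_mean_eq => s _ _.
by rewrite in_cons eq_sym (negPf xy).
Qed.

Lemma avoid_ge0 n x y : 0 <= avoid n x y.
Proof. by rewrite -(walk_mean_cst n x 0) walk_mean_le. Qed.

Lemma avoid_le1 n x y : avoid n x y <= 1.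
Proof.
by rewrite -(walk_mean_cst n x 1) walk_mean_le // => s; rewrite lern1 leq_b1.
Qed.

Lemma mean_le x (f g : V -> R) : (forall y, f y <= g y) ->
  (deg e x)%:R^-1 * \sum_(y <- nbr e x) f y <= (deg e x)%:R^-1 * \sum_(y <- nbr e x) g y.
Proof. by move=> fg; rewrite ler_wpM2l ?invr_ge0 // ler_sum. Qed.

Lemma avoid_nonincreasing m n x y : (m <= n)%N -> avoid n x y <= avoid m x y.
Proof.
move=> /subnK <-; elim: (n - m)%N => // k IH; apply: le_trans IH; rewrite addSn.
elim: (k + m)%N x => [|j IH] x.
  have [->|xy] := eqVneq x y; first by rewrite !avoidxx.
  rewrite [leRHS]/avoid /= inE eq_sym xy; exact: avoid_le1.
have [->|xy] := eqVneq x y; first by rewrite !avoidxx.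
by rewrite !(avoidS _ xy) mean_le.
Qed.

(** To miss [z] for [m + k] steps, the walk must miss [y] for [m] steps, or meet [y] by then and
    miss [z] for the next [k]. First-step analysis in [m] replaces the strong Markov property. *)
Lemma avoid_triangle m k x y z : avoid (m + k) x z <= avoid m x y + avoid k y z.
Proof.
elim: m x => [|m IH] x.
  rewrite add0n; have [->|xy] := eqVneq x y; first by rewrite avoidxx add0r.
  rewrite {2}/avoid /= inE eq_sym xy.
  by apply: le_trans (avoid_le1 _ _ _) _; rewrite lerDl avoid_ge0.
have [<-|xz] := eqVneq x z; first by rewrite avoidxx addr_ge0 ?avoid_ge0.
have [->|xy] := eqVneq x y.
  by rewrite avoidxx add0r avoid_nonincreasing // leq_addl.
rewrite addSn !avoidS // -(mean_cst x (avoid k y z)) -mulrDr -big_split /=.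
exact: mean_le.
Qed.

Definition no_return n x : R := walk_mean n x (fun s => (x \notin s)%:R).

(** From [y] the first step goes to [x] with probability [1 / deg y], and avoiding [y] for [n] more
    steps then means no return. *)
Lemma avoid_neighbor n x y : e x y -> avoid n x y <= (deg e y)%:R * no_return n.+1 y.
Proof.
move=> xy; rewrite /no_return /= mulrA divff ?mul1r; last first.
  by rewrite pnatr_eq0 -lt0n e_deg.
have xN : x \in nbr e y by rewrite mem_nbr // e_sym.
rewrite -/(avoid n _ y) (perm_big _ (perm_to_rem xN)) big_cons /= lerDl.
by apply: sumr_ge0 => z _; apply: avoid_ge0.
Qed.

Definition uniform_return :=
  forall eta : R, 0 < eta -> exists N, forall n, (N <= n)%N -> forall x, no_return n x <= eta.

(** Induction on the radius: hit a neighbour [z] of [y] first, then cross the last edge, where the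
    degree factor of [avoid_neighbor] is at most [D]. *)
Lemma uniform_hitting D r (eta : R) :
  (forall x, (deg e x <= D)%N) -> uniform_return -> 0 < eta ->
  exists N, forall n, (N <= n)%N ->
    forall x y, y \in gball e r x -> avoid n x y <= eta.
Proof.
move=> degD rec; elim: r eta => [|r IH] eta eta0.
  by exists 0%N => n _ x y; rewrite inE => /eqP ->; rewrite avoidxx ltW.
have [|N1 H1] := IH (eta / 2); first by rewrite divr_gt0.
have [|N2 H2] := rec (eta / 2 / D.+1%:R); first by rewrite !divr_gt0.
exists (N1 + N2)%N => n Nn x y /gballSP -/(_ e_lf)[z zx yz].
apply: le_trans (avoid_nonincreasing _ _ Nn) _.
apply: le_trans (avoid_triangle _ _ _ z _) _; rewrite [leRHS]splitr.
apply: lerD; first exact: H1 zx.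
case/orP: yz => [/eqP ->|zy]; first by rewrite avoidxx divr_ge0 // ltW.
apply: le_trans (avoid_neighbor _ zy) _.
have := H2 N2.+1 (leqnSn _) y; rewrite ler_pdivlMr // mulrC => /(le_trans _); apply.
rewrite ler_wpM2r ?ler_nat ?(leqW (degD _)) //.
by rewrite -(walk_mean_cst N2.+1 y 0) walk_mean_le.
Qed.

(** * Vertices near the path that it misses *)

Definition missed r x (s : seq V) := count (fun y => y \notin s) (gball e r x).

(* Every vertex near the path but not on it is charged to the first time the
   path comes near it; at that time the path visits a new vertex. *)
Fixpoint charge r (h s : seq V) : nat :=
  if s is x :: s' then ((x \notin h) * missed r x s + charge r (x :: h) s')%N else 0%N.

Fixpoint fresh (h s : seq V) : nat :=
  if s is x :: s' then ((x \notin h) + fresh (x :: h) s')%N else 0%N.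

Lemma freshE h s : fresh h s = #|` [fset y in s | y \notin h]|%fset.
Proof.
elim: s h => [|x s IH] h.
  by apply/esym/eqP; rewrite cardfs_eq0; apply/eqP/fsetP => y; rewrite in_fset_sieve inE.
rewrite /= IH; have [xh|xh] /= := boolP (x \in h).
  congr #|` _|%fset; apply/fsetP => y; rewrite !in_fset_sieve !in_cons.
  by have [->|] := eqVneq y x; rewrite ?xh ?andbF.
rewrite (cardfsD1 x [fset y in x :: s | y \notin h]%fset) in_fset_sieve mem_head xh.
congr (_ + #|` _|)%N; apply/fsetP => y; rewrite in_fsetD1 !in_fset_sieve !in_cons.
by have [->|] := eqVneq y x; rewrite ?andbF.
Qed.

(** Split the uncovered vertices by whether they lie near the head [x]. Those that do are counted by
    [missed], and there are none if [x] is in [h], as they would be near [h]. The others fall to the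
    induction hypothesis with [x] added to the history. *)
Lemma card_near_charge r h s :
  (#|` nearby e r s `\` ([fset y in s] `|` nearby e r h)|%fset <= charge r h s)%N.
Proof.
elim: s h => [|x s IH] h.
  rewrite leqn0 cardfs_eq0; apply/eqP/fsetP => y; rewrite in_fsetD andbC.
  by apply/negbTE/negP => /andP[/nearbyP[]].
set B := (X in #|` X|%fset).
set C := (nearby e r s `\` ([fset y in s] `|` nearby e r (x :: h)))%fset.
have nearC y : (y \in nearby e r (x :: h)) = (y \in gball e r x) || (y \in nearby e r h).
  by rewrite !in_fset_seq /= mem_cat.
have nearS y : (y \in nearby e r (x :: s)) = (y \in gball e r x) || (y \in nearby e r s).
  by rewrite !in_fset_seq /= mem_cat.
have sub : {subset B <= (if x \in h then [::] else
    [seq y <- gball e r x | y \notin x :: s]) ++ C}.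
  move=> y; rewrite /B in_fsetD in_fsetU negb_or in_fset_seq nearS.
  rewrite mem_cat in_fsetD in_fsetU nearC in_fset_seq.
  move=> /andP[/andP[ys yh]].
  have yN : y \notin s by move: ys; rewrite in_cons negb_or => /andP[].
  case: ifPn => xh.
    have yxN : y \notin gball e r x.
      by apply: contra yh => yx; apply/nearbyP; exists x.
    by rewrite (negPf yxN) (negPf yh) (negPf yN).
  by rewrite mem_filter ys (negPf yh) (negPf yN); case: (y \in gball e r x).
apply: leq_trans (uniq_leq_size (fset_uniq B) sub) _.
rewrite size_cat /= leq_add ?IH //; case: (x \in h) => //=.
by rewrite size_filter mul1n.
Qed.

Lemma mean_missed n x (B : seq V) :
  walk_mean n x (fun s => (count (fun y => y \notin x :: s) B)%:R) =
  \sum_(y <- B) avoid n x y.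
Proof.
rewrite -walk_mean_sum; apply: walk_mean_eq => s _ _.
by rewrite -sum1_count natr_sum big_mkcond; apply: eq_bigr => y _; case: ifP.
Qed.

(** A new vertex met with at least [K] steps to go has mean missed count at most [eta * D]; the last
    [K] times cost at most [D] each, which gives the additive term. *)
Lemma mean_charge (K r D : nat) (eta : R) n x h :
  (forall n, (K <= n)%N -> forall x y, y \in gball e r x -> avoid n x y <= eta) ->
  (forall x, (size (gball e r x) <= D)%N) -> 0 <= eta ->
  walk_mean n x (fun s => (charge r h (x :: s))%:R) <=
    eta * D%:R * walk_mean n x (fun s => (fresh h (x :: s))%:R) +
    D%:R * (minn n.+1 K)%:R.
Proof.
move=> hit gD eta0.
have sum_cst y c : \sum_(z <- gball e r y) (c : R) = c * (size (gball e r y))%:R.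
  by rewrite big_const_seq count_predT iter_addr_0 mulr_natr.
have step m y (g : seq V) : walk_mean m y (fun s => ((y \notin g) * missed r y (y :: s))%:R) <=
    eta * D%:R * (y \notin g)%:R + D%:R * (m < K)%N%:R.
  rewrite (walk_mean_eq (g := fun s => (y \notin g)%:R * (missed r y (y :: s))%:R));
    last by move=> s _ _; rewrite natrM.
  rewrite walk_meanZ mean_missed; have [yg|yg] := boolP (y \in g).
    by rewrite !mul0r mulr0 add0r mulr_ge0.
  rewrite mul1r mulr1; have [mK|Km] := ltnP m K.
    rewrite mulr1; apply: (@le_trans _ _ (\sum_(z <- gball e r y) 1)).
      by apply: ler_sum => z _; apply: avoid_le1.
    rewrite sum_cst mul1r; apply: (@le_trans _ _ D%:R); first by rewrite ler_nat.
    by rewrite lerDr mulr_ge0.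
  rewrite mulr0 addr0; apply: (@le_trans _ _ (\sum_(z <- gball e r y) eta)).
    by rewrite big_seq [leRHS]big_seq; apply: ler_sum => z zy; apply: hit.
  by rewrite sum_cst ler_wpM2l // ler_nat.
have natS m : (minn m.+1 K = (m < K) + minn m K)%N by lia.
elim: n x h => [|n IH] x h.
  have := step 0%N x h; rewrite /= addn0 => /le_trans; apply.
  by rewrite addn0 natS min0n addn0.
rewrite (walk_mean_eq (g := fun s =>
  ((x \notin h) * missed r x (x :: s))%:R + (charge r (x :: h) s)%:R));
  last by move=> s _ _; rewrite natrD.
rewrite [X in _ <= _ * X + _](walk_mean_eq (g := fun s =>
  (x \notin h)%:R + (fresh (x :: h) s)%:R)); last by move=> s _ _; rewrite natrD.
rewrite !walk_meanD walk_mean_cst natS natrD !mulrDr addrACA; apply: lerD; first exact: step.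
rewrite [leLHS]/= [X in _ <= _ * X + _]/= mulrCA -[X in _ <= _ + X](mean_cst x).
rewrite -mulrDr [X in _ <= _ * (X + _)]big_distrr -big_split /=.
apply: mean_le => y; exact: IH.
Qed.

Lemma mean_near (K r D : nat) (eta : R) n o :
  (forall n, (K <= n)%N -> forall x y, y \in gball e r x -> avoid n x y <= eta) ->
  (forall x, (size (gball e r x) <= D)%N) -> 0 <= eta ->
  walk_mean n o (fun s => #|` nearby e r [fset y in o :: s] `\` [fset y in o :: s]|%fset%:R)
   <= eta * D%:R * walk_mean n o (fun s => #|` [fset y in o :: s]|%fset%:R) + D%:R * K%:R.
Proof.
move=> hit gD eta0.
apply: (@le_trans _ _ (walk_mean n o (fun s => (charge r [::] (o :: s))%:R))).
  apply: walk_mean_le => s _ _; rewrite ler_nat.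
  apply: leq_trans (card_near_charge r [::] (o :: s)); apply: fsubset_leq_card.
  apply/fsubsetP => y; rewrite !in_fsetD in_fsetU negb_or => /andP[-> /=].
  move=> /nearbyP[x]; rewrite in_fset_seq => xs yx; apply/andP; split.
    by apply/nearbyP => -[].
  by apply/nearbyP; exists x.
apply: le_trans (mean_charge _ _ _ hit gD eta0) _; apply: lerD.
  rewrite ler_wpM2l ?mulr_ge0 // walk_mean_le // => s _ _; rewrite freshE ler_nat.
  by apply/fsubset_leq_card/fsubsetP => y; rewrite in_fset_sieve in_fset_seq andbT.
by rewrite ler_wpM2l // ler_nat geq_minr.
Qed.

(** By linearity of the mean: each point of the ball is missing from the range with probability at
    most [eta]. *)
Lemma walk_mean_card_ge L (eta : R) n o :
  (forall y, y \in gball e L o -> avoid n o y <= eta) ->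
  (1 - eta) * #|` [fset y in gball e L o]|%fset%:R <=
    walk_mean n o (fun s => #|` [fset y in o :: s]|%fset%:R).
Proof.
move=> hit; set B := [fset y in gball e L o]%fset.
apply: (@le_trans _ _ (walk_mean n o (fun s =>
    #|` B|%:R + -1 * (count (fun y => y \notin o :: s) (enum_fset B))%:R))).
  rewrite walk_meanD walk_meanZ mean_missed walk_mean_cst mulrBl mul1r mulN1r.
  rewrite lerD2l lerN2.
  apply: (@le_trans _ _ (\sum_(y <- enum_fset B) eta)); last first.
    by rewrite big_const_seq count_predT iter_addr_0 mulr_natr.
  rewrite big_seq [leRHS]big_seq; apply: ler_sum => y; rewrite in_fset_seq; exact: hit.
apply: walk_mean_le => s _ _; rewrite mulN1r lerBlDr -natrD ler_nat.
rewrite -(count_predC (fun y => y \notin o :: s)) addnC leq_add2r.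
rewrite -size_filter uniq_leq_size ?filter_uniq ?fset_uniq // => y.
by rewrite mem_filter /= negbK !in_fset_seq => /andP[].
Qed.

(* Once n is large, either the walk has visited more than L vertices in mean,
   which beats the additive error of [mean_near], or its component has radius
   at most L and is almost entirely covered. *)
Lemma mean_near_small D r (c eps : R) :
  (forall x, (deg e x <= D)%N) -> uniform_return -> 0 <= c -> 0 < eps ->
  exists N, forall n, (N <= n)%N -> forall o,
    c * walk_mean n o (fun s =>
      #|` nearby e r [fset y in o :: s] `\` [fset y in o :: s]|%fset%:R) <=
    eps * walk_mean n o (fun s => #|` [fset y in o :: s]|%fset%:R).
Proof.
move=> degD rec c0 eps0; pose G := (D.+1 ^ r)%N.
have gG x : (size (gball e r x) <= G)%N by apply: size_gball.
(* Makes [c * (eta * G)] at most [eps / 2], with divisors that are never zero. *)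
pose eta := eps / 2 / (1 + c) / G.+1%:R.
have c1 : 0 < 1 + c by rewrite ltr_wpDr.
have eta0 : 0 < eta by rewrite !divr_gt0.
have [K hitK] := uniform_hitting r degD rec eta0.
(* Once [L.+1 <= 2 * E], the additive error [c * (G * K)] is at most half of [eps * E]. *)
pose L := Num.truncn (4 * c * G%:R * K%:R / eps).
have Lge : 4 * c * G%:R * K%:R <= eps * L.+1%:R.
  by have /ltW := truncnS_gt (4 * c * G%:R * K%:R / eps); rewrite ler_pdivrMr // (mulrC eps).
(* The bound [2^-1] makes the mean range at least half of the ball; the other makes [c * eta'] at
   most [eps / 2]. *)
pose eta' := Num.min (2^-1) (eps / 2 / (1 + c)).
have eta'0 : 0 < eta' by rewrite lt_min invr_gt0 ltr0n !divr_gt0.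
have [N hitN] := uniform_hitting L degD rec eta'0.
exists N => n Nn o; set M := walk_mean n o _; set E := walk_mean n o _.
have eta'1 : eta' <= 2^-1 by rewrite ge_min lexx.
have eta'2 : c * eta' <= eps / 2.
  have : eta' <= eps / 2 / (1 + c) by rewrite ge_min lexx orbT.
  by rewrite ler_pdivlMr // => h; nra.
have := walk_mean_card_ge (hitN n Nn o); rewrite -/E => Ege.
have B0 : (0 : R) <= #|` [fset y in gball e L o]|%fset%:R by [].
have E0 : 0 <= E by apply: le_trans Ege; rewrite mulr_ge0 // subr_ge0; lra.
have [Lb|closed] := gball_growth e_lf L o.
  have LE : L.+1%:R <= 2 * E.
    have : L.+1%:R <= #|` [fset y in gball e L o]|%fset%:R :> R by rewrite ler_nat.
    by nra.
  have := mean_near n o hitK gG (ltW eta0); rewrite -/M -/E => ME.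
  have : c * (eta * G%:R) <= eps / 2.
    have h0 : 0 <= eps / 2 / (1 + c) by rewrite !divr_ge0 // ltW.
    have hE : eps / 2 / (1 + c) * (1 + c) = eps / 2 by rewrite mulfVK ?gt_eqF.
    have hG : eta * G%:R <= eps / 2 / (1 + c).
      by rewrite -[leRHS](@mulfVK _ G.+1%:R) ?pnatr_eq0 // ler_pM2l // ler_nat.
    have := ler_wpM2l c0 hG; nra.
  have h1 : c * M <= c * (eta * G%:R) * E + c * (G%:R * K%:R).
    by rewrite -mulrA -mulrDr ler_wpM2l.
  nra.
(* The ball is closed under adjacency, so the path and its [r]-neighbourhood stay inside, and the
   missing vertices are unvisited points of the ball. *)
have MB : M <= eta' * #|` [fset y in gball e L o]|%fset%:R.
  have -> : eta' * #|` [fset y in gball e L o]|%fset%:R =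
    \sum_(y <- enum_fset [fset y in gball e L o]%fset) eta'.
    by rewrite big_const_seq count_predT iter_addr_0 mulr_natr.
  apply: (@le_trans _ _ (\sum_(y <- enum_fset [fset y in gball e L o]%fset) avoid n o y)).
    rewrite -mean_missed walk_mean_le // => s os _; rewrite ler_nat -size_filter.
    rewrite uniq_leq_size ?fset_uniq // => y; rewrite in_fsetD in_fset_seq mem_filter.
    move=> /andP[-> /nearbyP[x]]; rewrite !in_fset_seq /= => xs yx.
    have sub z k : z \in gball e L o -> {subset gball e k z <= gball e L o}.
      move=> zL; elim: k => [w|k IH w]; first by rewrite inE => /eqP ->.
      case/gballSP => // v /IH vL /orP[/eqP -> //|]; exact: closed.
    apply: sub yx; move: xs; rewrite inE => /orP[/eqP ->|]; first exact: gball_center.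
    have subp w p : w \in gball e L o -> path e w p -> {subset p <= gball e L o}.
      elim: p w => // z p IHp w wL /= /andP[wz zp] v.
      have zL := closed _ _ wL wz.
      by rewrite inE => /orP[/eqP -> //|]; apply: IHp zL zp v.
    exact: subp (gball_center e_lf L o) os x.
  by rewrite big_seq [leRHS]big_seq; apply: ler_sum => y; rewrite in_fset_seq; apply: hitN.
have BE : #|` [fset y in gball e L o]|%fset%:R <= 2 * E by nra.
apply: le_trans (ler_wpM2l c0 MB) _; rewrite mulrA.
apply: le_trans (ler_wpM2r B0 eta'2) _; nra.
Qed.

End Walk.

(** * The law of the walk *)

Section Law.
Context {R : realType} {V : choiceType} (e : rel V).
Hypotheses (e_lf : locally_finite e) (e_deg : forall x, (1 <= deg e x)%N).

Fixpoint paths n x : seq (seq V) :=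
  if n is m.+1 then [seq y :: s | y <- enum_fset (nbr e x), s <- paths m y]
  else [:: [::]].

Fixpoint path_weight x s : R :=
  if s is y :: s' then (deg e x)%:R^-1 * path_weight y s' else 1.

Lemma pathsP n x s : s \in paths n x -> path e x s /\ size s = n.
Proof.
elim: n x s => [|n IH] x s /=; first by rewrite inE => /eqP ->.
by case/allpairsPdep => y [t [yx /IH[yt <-] ->]]; rewrite /= -(mem_nbr e_lf) yx.
Qed.

Lemma uniq_paths n x : uniq (paths n x).
Proof.
elim: n x => //= n IH x; apply: allpairs_uniq_dep => [|y _|]; first exact: fset_uniq.
  exact: IH.
by move=> [y s] [z t] _ _ /= [-> ->].
Qed.

Lemma walk_meanE n x f :
  walk_mean e n x f = \sum_(s <- paths n x) path_weight x s * f s.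
Proof.
elim: n x f => [|n IH] x f /=; first by rewrite big_seq1 mul1r.
rewrite big_allpairs_dep big_distrr; apply: eq_bigr => y _.
by rewrite IH big_distrr; apply: eq_bigr => s _ /=; rewrite mulrA.
Qed.

Lemma prod_srw_step x0 x s : path e x s ->
  \prod_(i < size s) srw_step e R (nth x0 (x :: s) i) (nth x0 (x :: s) i.+1) =
  path_weight x s.
Proof.
elim: s x => [|y s IH] x /=; first by rewrite big_ord0.
by case/andP => xy ys; rewrite big_ord_recl /= {1}/srw_step xy -IH.
Qed.

Context {d : measure_display} {Omega : measurableType d}.
Context (X : nat -> Omega -> V) (o : V) (P : probability Omega R).
Hypothesis X_srw : is_srw e X o P.

Lemma measurable_all (A : nat -> set Omega) n :
  (forall i, measurable (A i)) -> measurable [set w | forall i, (i <= n)%N -> A i w].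
Proof.
move=> mA; rewrite (_ : [set w | _] = \bigcap_(i in [set i | (i <= n)%N]) A i).
  exact: bigcap_measurableType.
by apply/seteqP; split.
Qed.

Lemma measurable_has (A : nat -> set Omega) n :
  (forall i, measurable (A i)) -> measurable [set w | exists2 i, (i <= n)%N & A i w].
Proof.
move=> mA; rewrite (_ : [set w | _] = \bigcup_(i in [set i | (i <= n)%N]) A i).
  exact: bigcup_measurable.
by apply/seteqP; split.
Qed.

Definition follows (s : seq V) : set Omega :=
  [set w | forall i, (i <= size s)%N -> X i w = nth o (o :: s) i].

Lemma measurable_follows s : measurable (follows s).
Proof. by apply: measurable_all => i; apply: X_srw.1. Qed.

Lemma probability_follows s : path e o s -> P (follows s) = (path_weight o s)%:E.
Proof. by move=> os; rewrite /follows X_srw.2 eqxx mul1r prod_srw_step. Qed.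

Lemma trivIset_follows n : trivIset [set` paths n o] follows.
Proof.
move=> s t /= /pathsP[_ sn] /pathsP[_ tn] [w [ws wt]].
apply: (@eq_from_nth _ o); rewrite ?sn ?tn // => i i_n.
have := ws i.+1; have := wt i.+1; rewrite sn tn => /(_ i_n) -> /(_ i_n) /=.
exact: esym.
Qed.

(** The cylinders of the paths selected by [Phi] are disjoint subsets of [E], and the mean is the
    sum of their probabilities. *)
Lemma sum_follows_le n (E : set Omega) (Phi : pred (seq V)) :
  measurable E -> (forall s, s \in paths n o -> Phi s -> follows s `<=` E) ->
  ((walk_mean e n o (fun s => (Phi s)%:R))%:E <= P E)%E.
Proof.
move=> mE sE; pose L := [seq s <- paths n o | Phi s].
have -> : walk_mean e n o (fun s => (Phi s)%:R) = \sum_(s <- L) path_weight o s.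
  rewrite walk_meanE big_filter [RHS]big_mkcond; apply: eq_bigr => s _.
  by case: (Phi s); rewrite ?mulr1 ?mulr0.
rewrite -sumEFin; have LP s : s \in L -> s \in paths n o /\ Phi s.
  by rewrite mem_filter => /andP[].
rewrite (eq_big_seq (fun s => P (follows s))); last first.
  by move=> s /LP[/pathsP[os _] _]; rewrite probability_follows.
rewrite fsbig_seq ?filter_uniq ?uniq_paths //= -measure_fin_bigcup; last 3 first.
- exact: finite_seq.
- by apply: sub_trivIset (@trivIset_follows n) => s /=; apply: (fun h => (LP s h).1).
- by move=> s _; apply: measurable_follows.
apply: le_measure; rewrite ?inE //.
  apply: fin_bigcup_measurable; first exact: finite_seq.
  by move=> s _; apply: measurable_follows.
by move=> w [s /= /LP[sp sPhi] sw]; apply: sE sw.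
Qed.

(** The lower bound is applied to [E] and to its complement; the two means add up to one, which
    forces equality. *)
Lemma walk_law n (E : set Omega) (Phi : pred (seq V)) :
  measurable E ->
  (forall s w, s \in paths n o -> follows s w -> E w <-> Phi s) ->
  P E = (walk_mean e n o (fun s => (Phi s)%:R))%:E.
Proof.
move=> mE EPhi; apply/eqP; rewrite eq_le; apply/andP; split; last first.
  by apply: sum_follows_le => // s sp sPhi w ws; apply/(EPhi s w sp ws).
have : ((walk_mean e n o (fun s => (~~ Phi s)%:R))%:E <= P (~` E))%E.
  apply: sum_follows_le; first exact: measurableC.
  by move=> s sp sPhi w ws /= /(EPhi s w sp ws); apply/negP.
have -> : walk_mean e n o (fun s => (~~ Phi s)%:R) =
    1 - walk_mean e n o (fun s => (Phi s)%:R) :> R.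
  transitivity (walk_mean e n o (fun s => 1 + -1 * (Phi s)%:R : R)); last first.
    by rewrite walk_meanD walk_meanZ walk_mean_cst // mulN1r.
  by apply: walk_mean_eq => // s _ _; case: (Phi s); rewrite ?mulr0 ?addr0 ?mulr1 ?subrr.
rewrite probability_setC //.
rewrite -[P E]fineK ?fin_num_measure //.
by rewrite -EFinB !lee_fin; lra.
Qed.

(** [A] is finite, so the event is a finite combination of the measurable events [X i w = a], even
    when [V] is uncountable. *)
Lemma measurable_walk_range n A : measurable [set w | walk_range X n w = A].
Proof.
have memX i w v : (i <= n)%N -> X i w = v -> v \in walk_range X n w.
  move=> i_n <-; rewrite in_fset_seq; apply/mapP; exists i => //.
  by rewrite mem_iota /= add0n ltnS.
have memXV w v : v \in walk_range X n w -> exists2 i, (i <= n)%N & X i w = v.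
  rewrite in_fset_seq => /mapP[i]; rewrite mem_iota add0n ltnS => i_n ->.
  by exists i.
have -> : [set w | walk_range X n w = A] =
   [set w | forall i, (i <= n)%N -> X i w \in A] `&`
   \bigcap_(a in [set` A]) [set w | exists2 i, (i <= n)%N & X i w = a].
  apply/seteqP; split => w /=.
    by move=> <-; split => [i i_n|a /memXV //]; apply: memX i_n _.
  move=> [sub sup]; apply/fsetP => v; apply/idP/idP.
    by move=> /memXV[i i_n <-]; apply: sub.
  by move=> vA; have [i i_n] := sup v vA; apply: memX.
apply: measurableI.
  apply: (@measurable_all (fun i => [set w | X i w \in A])) => i.
  rewrite (_ : mkset _ = \bigcup_(a in [set` A]) [set w | X i w = a]).
    by apply: fin_bigcup_measurable => // a _; apply: X_srw.1.
  by apply/seteqP; split => w /= => [XA|[a aA ->] //]; exists (X i w).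
apply: fin_bigcap_measurable => // a _.
by apply: (@measurable_has (fun i => [set w | X i w = a])) => i; apply: X_srw.1.
Qed.

Lemma walk_range_follows s w : follows s w ->
  walk_range X (size s) w = [fset v in o :: s]%fset.
Proof.
move=> ws.
suff E : [seq X i w | i <- iota 0 (size s).+1] = o :: s by rewrite /walk_range E.
apply: (@eq_from_nth _ o); rewrite size_map size_iota // => i i_s.
rewrite (nth_map 0%N) ?size_iota // nth_iota //= add0n; exact: ws.
Qed.

Lemma prob_rangeE n A : prob_range X (fun=> P) n o A =
  walk_mean e n o (fun s => ([fset v in o :: s]%fset == A)%:R).
Proof.
rewrite /prob_range (@walk_law n _ (fun s => [fset v in o :: s]%fset == A)) //.
  exact: measurable_walk_range.
move=> s w /pathsP[_ sn] ws; rewrite -sn /= walk_range_follows //.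
by split => /eqP.
Qed.

Lemma no_returnE n :
  P [set w | forall i, (1 <= i <= n)%N -> X i w <> o] = (no_return e n o)%:E.
Proof.
apply: walk_law.
  rewrite (_ : mkset _ =
    [set w | forall i, (i <= n)%N -> [set w | (0 < i)%N -> X i w <> o] w]).
    apply: measurable_all => -[|i].
      have -> : [set w | (0 < 0)%N -> X 0 w <> o] = setT by apply/seteqP; split.
      exact: measurableT.
    have -> : [set w | (0 < i.+1)%N -> X i.+1 w <> o] = ~` [set w | X i.+1 w = o].
      by apply/seteqP; split => w /=; [apply | move=> h _].
    by apply: measurableC; apply: X_srw.1.
  apply/seteqP; split => w /= h i.
    by move=> i_n i0; apply: h; rewrite i0.
  by move=> /andP[i0 i_n]; apply: h.
move=> s w /pathsP[_ sn] ws; split=> [h|os i /andP[]].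
  apply/negP => /(nthP o)[i i_s oi]; apply: (h i.+1); first by rewrite -sn.
  by rewrite ws.
case: i => // i _ i_n; rewrite ws ?sn //= => oi.
by case/negP: os; rewrite -oi mem_nth // sn.
Qed.

(* The size of the range need not be measurable when V is uncountable, but it
   dominates a simple function. *)
Lemma expected_range_ge n :
  ((walk_mean e n o (fun s => #|` [fset v in o :: s]|%fset%:R))%:E <=
    expected_range X (fun=> P) n o)%E.
Proof.
rewrite /expected_range expectation.unlock.
pose g w : \bar R := (\sum_(s <- paths n o)
   (#|` [fset v in o :: s]|%fset%:R * \1_(follows s) w)%:E)%E.
have g0 w : (0 <= g w)%E by apply: sume_ge0 => s _; rewrite lee_fin mulr_ge0.
have gle w : (g w <= #|` walk_range X n w|%fset%:R%:E)%E.
  have [[s sp ws]|none] := pselect (exists2 s, s \in paths n o & follows s w).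
    rewrite /g (bigD1_seq s) ?uniq_paths //= big_seq_cond big1 => [|t /andP[tp ts]].
      rewrite adde0 indicE mem_set // mulr1 lee_fin ler_nat.
      by have [_ <-] := pathsP sp; rewrite walk_range_follows.
    rewrite indicE memNset ?mulr0 // => wt; case/eqP: ts.
    by apply: (trivIset_follows (n := n)) => //; exists w.
  rewrite /g big_seq big1 // => s sp; rewrite indicE memNset ?mulr0 // => ws.
  by apply: none; exists s.
apply: (@le_trans _ _ (\int[P]_w g w)%E); last first.
  (* Integrals as suprema over simple functions are monotone whether or not the larger integrand is
     measurable. *)
  rewrite !ge0_integralTE //.
  apply: ge_ereal_sup => _ [h hg <-]; apply: ereal_sup_ubound.
  by exists h => // w; apply: le_trans (gle w).
rewrite ge0_integral_sum //.
- rewrite walk_meanE -sumEFin big_seq [leRHS]big_seq; apply: lee_sum => s sp.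
  under eq_integral do rewrite EFinM.
  rewrite ge0_integralZl_EFin //; last first.
  + by apply/measurable_EFinP; apply: measurable_indic; apply: measurable_follows.
  rewrite integral_indic ?setIT //; last exact: measurable_follows.
  have [os _] := pathsP sp; have /= -> := probability_follows os.
  by rewrite -EFinM lee_fin mulrC.
- move=> s; apply/measurable_EFinP; apply: measurable_funM => //.
  by apply: measurable_indic; apply: measurable_follows.
Qed.

(** * Entropy bounded by mean code length *)

Lemma xlnxV_ge0 (x : R) : 0 <= x -> x <= 1 -> 0 <= x * ln x^-1.
Proof.
rewrite le_eqVlt => /predU1P[<-|x0] x1; first by rewrite mul0r.
by apply: mulr_ge0; [exact: ltW | rewrite ln_ge0 // invf_ge1].
Qed.

Lemma prob_range_ge0 n A : 0 <= prob_range X (fun=> P) n o A.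
Proof. exact: fine_ge0. Qed.

Lemma prob_range_le1 n A : prob_range X (fun=> P) n o A <= 1.
Proof.
rewrite prob_rangeE -[leRHS](walk_mean_cst e_deg n o 1) walk_mean_le // => s _ _.
by rewrite lern1 leq_b1.
Qed.

Lemma entropy_range_ge0 n : (0 <= entropy_range e X (fun=> P) n o)%E.
Proof.
apply: esum_ge0 => A _; rewrite lee_fin.
by rewrite xlnxV_ge0 ?prob_range_ge0 ?prob_range_le1.
Qed.

(** Take [1 + t <= expR t] at [t = ln (p A)^-1 - cost A]. Multiplied by [p A], it bounds the
    difference of the two terms by [q A - p A], whose sum is at most zero. *)
Lemma gibbs (I : eqType) (F : seq I) (p q cost : I -> R) :
  (forall A, 0 <= p A) -> \sum_(A <- F) q A <= \sum_(A <- F) p A ->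
  {in F, forall A, expR (- cost A) <= q A} ->
  \sum_(A <- F) p A * ln (p A)^-1 <= \sum_(A <- F) p A * cost A.
Proof.
move=> p0 qp cq; apply: (@le_trans _ _ (\sum_(A <- F) (p A * cost A + (q A - p A)))).
  rewrite big_seq [leRHS]big_seq; apply: ler_sum => A AF.
  have := cq A AF; have := p0 A; rewrite le_eqVlt => /predU1P[<-|pA] qA.
    by rewrite !mul0r add0r subr0; apply: le_trans qA; apply: expR_ge0.
  have := expR_ge1Dx (ln (p A)^-1 - cost A).
  rewrite expRD lnK ?posrE ?invr_gt0 // => h.
  have := ler_wpM2l (ltW pA) h; rewrite mulrA mulfV ?gt_eqF // mul1r; nra.
by rewrite big_split sumrB /= gerDl subr_le0.
Qed.

(** Turns a code for the possible ranges into an entropy bound, with the mean cost expressed as a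
    mean over paths. *)
Lemma entropy_range_le n (q : {fset V} -> R) (cost : {fset V} -> R) :
  let F := undup [seq [fset v in o :: s]%fset | s <- paths n o] in
  \sum_(A <- F) q A <= 1 -> {in F, forall A, expR (- cost A) <= q A} ->
  (entropy_range e X (fun=> P) n o <=
   (walk_mean e n o (fun s => cost [fset v in o :: s]%fset))%:E)%E.
Proof.
move=> F q1 cq; set p := prob_range X (fun=> P) n o.
have pE A : p A = walk_mean e n o (fun s => ([fset v in o :: s]%fset == A)%:R).
  exact: prob_rangeE.
have p0 A : 0 <= p A := prob_range_ge0 n A.
have mem_paths s : path e o s -> size s = n -> s \in paths n o.
  elim: n {p F q1 cq pE p0} o s => [|m IH] x [|y s] //= /andP[xy ys] [sm].
  by apply/allpairsPdep; exists y, s; rewrite mem_nbr //; split=> //; apply: IH.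
have sum_p (g : {fset V} -> R) :
    \sum_(A <- F) p A * g A = walk_mean e n o (fun s => g [fset v in o :: s]%fset).
  transitivity (walk_mean e n o (fun s => \sum_(A <- F) g A * ([fset v in o :: s]%fset == A)%:R)).
    rewrite walk_mean_sum //; apply: eq_bigr => A _.
    by rewrite pE mulrC walk_meanZ.
  apply: walk_mean_eq => // s os sn.
  have AF : [fset v in o :: s]%fset \in F by rewrite mem_undup; apply: map_f; apply: mem_paths.
  rewrite (bigD1_seq _ AF) ?undup_uniq //= eqxx mulr1 big1 ?addr0 // => A.
  by rewrite eq_sym => /negPf ->; rewrite mulr0.
apply: (@le_trans _ _ (\sum_(A <- F) p A * ln (p A)^-1)%:E); last first.
  rewrite lee_fin -sum_p; apply: gibbs p0 _ cq.
  by have := sum_p (fun=> 1); under eq_bigr do rewrite mulr1; rewrite walk_mean_cst // => ->.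
have plnp A : 0 <= p A * ln (p A)^-1 by apply: xlnxV_ge0 => //; apply: prob_range_le1.
rewrite -sumEFin fsbig_seq ?undup_uniq //= -esum_fset; last 2 first.
- exact: finite_seq.
- by move=> A _; rewrite lee_fin.
rewrite /entropy_range esum_mkcond [X in (_ <= X)%E]esum_mkcond; apply: le_esum => A _.
rewrite -/(p A); have [AF|AF] := boolP (A \in [set` F]).
  by case: ifP => // _; rewrite lee_fin.
(* A set outside [F] is the trace of no graph path, so it has probability zero. *)
case: ifP => // _; rewrite lee_fin (_ : p A = 0) ?mul0r //.
rewrite pE -[RHS](walk_mean_cst e_deg n o); apply: walk_mean_eq => // s os sn.
case: eqP => // sA; case/negP: AF; rewrite inE /= mem_undup -sA.
by apply: map_f; apply: mem_paths.
Qed.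

End Law.

(** * The theorem *)

Lemma cvge0P (R : realType) (f : nat -> \bar R) :
  (forall n, (0 <= f n)%E) -> f @ \oo --> 0%E <->
  (forall eps : R, 0 < eps -> exists N, forall n, (N <= n)%N -> (f n <= eps%:E)%E).
Proof.
move=> f0; split=> [/fine_cvgP[ffin /cvgrPdist_le fcvg] eps eps0|fle].
  have [N _ HN] := ffin; have [M _ HM] := fcvg eps eps0.
  exists (maxn N M) => n; rewrite geq_max => /andP[Nn Mn].
  rewrite -[f n]fineK ?(HN n) // lee_fin; have := HM n Mn => /=.
  by rewrite sub0r normrN ger0_norm // fine_ge0.
have fin n eps : (f n <= eps%:E)%E -> f n \is a fin_num.
  by move=> fn; rewrite ge0_fin_numE // (le_lt_trans fn) // ltry.
apply/fine_cvgP; split.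
  by have [N HN] := fle 1 ltr01; exists N => // n /= /HN; apply: fin.
apply/cvgrPdist_le => eps eps0; have [N HN] := fle eps eps0; exists N => // n /= Nn.
have fn := HN n Nn; rewrite sub0r normrN ger0_norm ?fine_ge0 //.
by rewrite -lee_fin fineK // (fin _ _ fn).
Qed.

Section Main.
Context {R : realType} {V : choiceType} (e : rel V).
Hypotheses (e_sym : symmetric e) (e_lf : locally_finite e).
Hypothesis e_deg : forall x, (1 <= deg e x)%N.

Lemma bounded_degreesP : bounded_degrees e R -> exists D, forall x, (deg e x <= D)%N.
Proof.
rewrite /bounded_degrees; set s := ereal_sup _.
have degs x : ((deg e x)%:R%:E <= s)%E by apply: ereal_sup_ubound; exists x.
case: s degs => [r degs _|//|degs _]; last first.
  by exists 0%N => x; have := degs x; rewrite leeNy_eq.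
exists (Num.truncn r) => x; have := degs x; rewrite lee_fin => xr.
by rewrite truncn_ge_nat // (le_trans _ xr).
Qed.

Lemma subexponential_radius (eps m : R) :
  subexponential_boundary_i_o e R -> 0 < eps -> 0 < m ->
  exists r, expR (- (eps * r%:R)) <= m /\
    forall x, #|` sphere_fset e r x|%:R <= expR (eps * r%:R).
Proof.
move=> bnd eps0 m0; have := bnd eps eps0.
(* For [r >= r1] one gets [m^-1 < eps * r < expR (eps * r)]. *)
pose r1 := (Num.truncn (m^-1 / eps)).+1 => infS.
have [r r1r rS] : exists2 r, (r1 <= r)%N &
    (ereal_sup [set ((outer_boundary_size e R x r)%:R : R)%:E | x in [set: V]]
      <= (expR (eps * r%:R))%:E)%E.
  apply: contrapT => none; apply: infS; apply: sub_finite_set (finite_II r1).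
  move=> r /= rS; rewrite ltnNge; apply/negP => r1r; apply: none.
  by exists r.
exists r; split=> [|x].
  rewrite expRN invf_ple ?posrE ?expR_gt0 //.
  have : m^-1 / eps < r%:R.
    by apply: lt_le_trans (truncnS_gt _) _; rewrite ler_nat.
  rewrite ltr_pdivrMr // mulrC => mr.
  by apply: le_trans (expR_ge1Dx _); rewrite ltW // (lt_trans mr) // ltrDr.
rewrite -lee_fin; apply: le_trans rS.
apply: (@le_trans _ _ (outer_boundary_size e R x r)%:R%:E).
  by rewrite lee_fin ler_nat card_sphere.
by apply: ereal_sup_ubound; exists x.
Qed.

Context {d : measure_display} {Omega : measurableType d}.
Context (X : nat -> Omega -> V) (P : V -> probability Omega R).
Hypothesis X_srw : forall o, is_srw e X o (P o).

Lemma uniformly_recurrent_return :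
  uniformly_recurrent X P -> uniform_return e (R := R).
Proof.
move=> rec eta eta0.
have [[x0 _]|/forallNP none] := pselect (exists o : V, True); last first.
  by exists 0%N => n _ x; case: (none x).
have sup_ge0 n : (0 <= ereal_sup [set P o [set w |
    forall i, (1 <= i <= n)%N -> X i w <> o] | o in [set: V]])%E.
  apply: le_ereal_sup_tmp; exists (P x0 [set w |
    forall i, (1 <= i <= n)%N -> X i w <> x0]) => //; by exists x0.
have [to0 _] := cvge0P sup_ge0.
have [N HN] := to0 rec eta eta0; exists N => n /HN Hn x.
rewrite -lee_fin -(no_returnE e_lf e_deg (X_srw x)); apply: le_trans Hn.
by apply: ereal_sup_ubound; exists x.
Qed.

Lemma entropy_range_small (eps : R) :
  bounded_degrees e R -> uniformly_recurrent X P ->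
  subexponential_boundary_i_o e R -> 0 < eps ->
  exists N, forall n, (N <= n)%N -> forall o,
    (entropy_range e X P n o <=
      (eps * walk_mean e n o (fun s => #|` [fset v in o :: s]|%fset%:R))%:E)%E.
Proof.
move=> /bounded_degreesP[D degD] /uniformly_recurrent_return rec bnd eps0.
(* Seven parts pay for the code per point of the range, one for the missing vertices. *)
pose eps' := eps / 8; have eps'0 : 0 < eps' by rewrite divr_gt0.
have [|r [er_m sphb]] := @subexponential_radius eps' (Num.min eps' 2^-1) bnd eps'0.
  by rewrite lt_min eps'0 invr_gt0 ltr0n.
have er_eps : expR (- (eps' * r%:R)) <= eps' by rewrite (le_trans er_m) // ge_min lexx.
have er_half : expR (- (eps' * r%:R)) <= 2^-1.
  by rewrite (le_trans er_m) // ge_min lexx orbT.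
pose c := - ln (1 - expR (- eps')).
have c0 : 0 <= c by rewrite oppr_ge0 ln_le0 // lerBlDr lerDl expR_ge0.
have [N HN] := mean_near_small e_sym e_lf e_deg r degD rec c0 eps'0.
exists N => n /HN Hn o.
pose F := undup [seq [fset v in o :: s]%fset | s <- paths e n o].
have [|q q1 cq] := @range_code _ _ _ e_sym e_lf o r eps' F eps'0 er_eps er_half sphb (undup_uniq _).
  move=> A; rewrite mem_undup => /mapP[s /(pathsP e_lf)[os _] ->].
  by split; [rewrite in_fset_seq mem_head | apply: reach_path].
apply: le_trans (entropy_range_le e_lf e_deg (X_srw o) q1 cq) _.
rewrite lee_fin (walk_mean_eq e_lf (g := fun s => 7 * eps' * #|` [fset v in o :: s]|%fset%:R +
  c * #|` nearby e r [fset v in o :: s] `\` [fset v in o :: s]|%fset%:R)) //; last first.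
  by move=> s _ _; rewrite /c mulNr.
rewrite walk_meanD !walk_meanZ; have := Hn o.
have : eps = 8 * eps' by rewrite /eps' mulrC divfK.
by move=> ->; lra.
Qed.

End Main.

Theorem theorem1p2 (R : realType) (V : choiceType) (e : rel V)
  (e_sym : symmetric e) (e_irr : irreflexive e)
  (e_lf : locally_finite e) (e_deg : forall x, (1 <= deg e x)%N)
  (d : measure_display) (Omega : measurableType d)
  (X : nat -> Omega -> V) (P : V -> probability Omega R)
  (X_srw : forall o, is_srw e X o (P o))
  (e_bdd : bounded_degrees e R)
  (e_rec : uniformly_recurrent X P)
  (e_bnd : subexponential_boundary_i_o e R) :
  (fun n : nat => ereal_sup
     [set (entropy_range e X P n o / expected_range X P n o)%E
     | o in [set: V]]) @ \oo --> 0%E.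
Proof.
have [[v0 _]|/forallNP none] := pselect (exists o : V, True); last first.
  (* On an empty [V] the suprema are [-oo], so uniform recurrence itself fails. *)
  have [[N _ HN] _] := (fine_cvgP _ _).1 e_rec; have := HN N (leqnn N).
  rewrite (_ : [set _ | _ in _] = set0) ?ereal_sup0 //.
  by apply/seteqP; split => // x [v _ _]; case: (none v).
have mean_ge1 n o : 1 <= walk_mean e n o (fun s => #|` [fset v in o :: s]|%fset%:R) :> R.
  rewrite -[leLHS](walk_mean_cst e_deg n o 1) walk_mean_le // => s _ _.
  by rewrite ler1n cardfs_gt0; apply/fset0Pn; exists o; rewrite in_fset_seq mem_head.
have exp_ge n o : ((walk_mean e n o (fun s => #|` [fset v in o :: s]|%fset%:R))%:E <=
    expected_range X P n o)%E := expected_range_ge e_lf (X_srw o) n.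
have ratio_ge0 n o : (0 <= entropy_range e X P n o / expected_range X P n o)%E.
  rewrite mule_ge0 ?inve_ge0 ?(entropy_range_ge0 e_lf e_deg (X_srw o)) //.
  by apply: le_trans (exp_ge n o); rewrite lee_fin (le_trans ler01).
apply/cvge0P => [n|eps eps0].
  by apply: le_ereal_sup_tmp; eexists; [exists v0 | apply: (ratio_ge0 n v0)].
have [N HN] := entropy_range_small e_sym e_lf e_deg X_srw e_bdd e_rec e_bnd eps0.
exists N => n /HN Hn; apply: ge_ereal_sup => _ [v _ <-].
have := exp_ge n v; have := mean_ge1 n v; have := Hn v; set E := walk_mean _ _ _ _.
(* Only a lower bound on the expectation is at hand: at [+oo] the quotient is zero by convention,
   and [-oo] contradicts the bound. *)
case: (expected_range X P n v) => [x|_ _ _|//]; last first.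
  by rewrite invey mule0 lee_fin ltW.
rewrite lee_fin => HE E1 Ex; have x_gt0 : 0 < x by apply: lt_le_trans Ex; apply: lt_le_trans E1.
rewrite inver gt_eqF // lee_pdivrMr //; apply: le_trans HE _.
by rewrite -EFinM lee_fin ler_pM2l.
Qed.
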